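(* Let $A$ generate a $C_0$-semigroup $(T(t))_{t\ge 0}$ on a Banach space $X$, let $U$ be a Banach space and $B\in \mathcal{L}(U,X_{-1})$. Let $p\in[1,\infty]$ and $q\in[1,\infty)$. The following assertions are equivalent. (i) The system $\Sigma(A,B)$ is $L^p$-$L^q$-ISS. (ii) The system $\Sigma(A,B)$ is infinite-time $L^p$-$L^q$-admissible and $(T(t))_{t\ge0}$ is exponentially stable. (iii) There exist $M,G>0$ such that $$\|\phi(\cdot,x,u)\|_{L^q([0,t],X)}\le M\|x\|+G\|u\|_{L^p([0,t],U)}$$ for all $t\ge0$, $x\in X$, and $u\in L^p([0,t],U)$.
   Context: For a $C_0$-semigroup $(T(t))_{t\ge0}$ with generator $A$ on a Banach space $X$, the extrapolation space $X_{-1}$ is the completion of $X$ with respect to $\|x\|_{-1}:=\|(\lambda-A)^{-1}x\|$ for a fixed $\lambda\in\rho(A)$ (different choices give equivalent norms). The semigroup extends uniquely to a $C_0$-semigroup $(T_{-1}(t))_{t\ge0}$ on $X_{-1}$, whose generator $A_{-1}$ extends $A$ and has domain $X$. For $B\in\mathcal{L}(U,X_{-1})$, $\Sigma(A,B)$ denotes the system $\dot x(t)=Ax(t)+Bu(t)$, $t\ge0$, $x(0)=x_0$. For $\tau\ge0$ and $u\in L^p([0,\tau],U)$ put $\Phi_\tau u:=\int_0^\tau T_{-1}(\tau-s)Bu(s)\,ds\in X_{-1}$; the mild solution is $\phi(\tau,x_0,u)=T(\tau)x_0+\Phi_\tau u\in X_{-1}$. $(T(t))_{t\ge0}$ is exponentially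 stable if there are $M,\omega>0$ with $\|T(t)\|\le Me^{-\omega t}$ for all $t\ge0$. For $p,q\in[1,\infty]$, $\Sigma(A,B)$ is (finite-time) $L^p$-$L^q$-admissible if for some (equivalently, all) $t>0$: $u\in L^p([0,t],U)$ implies $\Phi_{(\cdot)}u\in L^q([0,t],X)$. It is infinite-time $L^p$-$L^q$-admissible if it is $L^p$-$L^q$-admissible and there is a constant $c_\infty<\infty$ independent of $t$ such that $\|\Phi_{(\cdot)}u\|_{L^q([0,t],X)}\le c_\infty\|u\|_{L^p([0,t],U)}$ for all $t\ge 0$ and $u\in L^p([0,t],U)$. $\mathcal{K}_\infty$ is the set of continuous, strictly increasing, unbounded functions $\gamma:[0,\infty)\to[0,\infty)$ with $\gamma(0)=0$. $\Sigma(A,B)$ is $L^p$-$L^q$-ISS if it is $L^p$-$L^q$-admissible and there are $\sigma,\gamma\in\mathcal{K}_\infty$ such that $\|\phi(\cdot,x,u)\|_{L^q([0,t],X)}\le\sigma(\|x\|)+\gamma(\|u\|_{L^p([0,t],U)})$ for all $t\ge0$, $x\in X$, $u\in L^p([0,t],U)$. In (iii), the inequality includes the requirement that $\phi(\cdot,x,u)\in L^q([0,t],X)$. *)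

(* Defs.v *)
From HB Require Import structures.
From mathcomp Require Import all_boot all_order all_algebra.
From mathcomp Require Import all_classical all_reals all_analysis.

Set Implicit Arguments.
Unset Strict Implicit.
Unset Printing Implicit Defensive.

Import Order.TTheory GRing.Theory Num.Theory.
Import numFieldNormedType.Exports.

Local Open Scope classical_set_scope.
Local Open Scope ring_scope.

(* A function on [0, t] is represented by a function on R; every notion below
   depends only on its values on [0, t], and only up to null sets.  Measurable
   sets are Borel sets, but "almost everywhere" allows any subset of a null
   Borel set, so measurability is Lebesgue measurability. *)
Section Bochner.
Context {R : realType} {V : normedModType R}.

Definition simple_measurable (s : {fimfun R >-> V}) : Prop :=
  forall v : V, measurable (s @^-1` [set v] : set (measurableTypeR R)).

Definition simple_integral (t : R) (s : {fimfun R >-> V}) : V :=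
  \sum_(v \in range s)
     fine (lebesgue_measure (`[0, t] `&` s @^-1` [set v])) *: v.

Definition simple_approx (t : R) (f : R -> V) (s : nat -> {fimfun R >-> V}) :
    Prop :=
  (forall n, simple_measurable (s n)) /\
  {ae lebesgue_measure, forall x : R,
     x \in `[0, t] -> s n x @[n --> \oo] --> f x}.

Definition strongly_measurable (t : R) (f : R -> V) : Prop :=
  exists s, simple_approx t f s.

Definition is_bochner_integral (t : R) (f : R -> V) (v : V) : Prop :=
  exists s : nat -> {fimfun R >-> V},
    [/\ simple_approx t f s,
        (\int[lebesgue_measure]_(x in `[0%R, t]) `|f x - s n x|%R%:E)%E
          @[n --> \oo] --> 0%E
      & simple_integral t (s n) @[n --> \oo] --> v].

(* 0 when f is not Bochner integrable on [0, t]. *)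
Definition bochner_integral (t : R) (f : R -> V) : V :=
  xget 0 [set v | is_bochner_integral t f v].

Definition Lp_norm (t : R) (p : \bar R) (f : R -> V) : \bar R :=
  ('N[lebesgue_measure]_p [(fun x : R => `|f x|%:E) \_ `[0%R, t]])%E.

Definition in_Lp (t : R) (p : \bar R) (f : R -> V) : Prop :=
  strongly_measurable t f /\ (Lp_norm t p f < +oo)%E.

End Bochner.

Section Semigroups.
Context {R : realType} {X : normedModType R}.

(* Only the values of T at nonnegative times matter. *)
Definition C0_semigroup (T : R -> {linear X -> X}) : Prop :=
  [/\ forall t : R, 0 <= t -> continuous (T t),
      forall x, T 0 x = x,
      forall (s t : R) x, 0 <= s -> 0 <= t -> T (s + t) x = T s (T t x)
    & forall x, T t x @[t --> 0^'+] --> x].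

Definition exponentially_stable (T : R -> {linear X -> X}) : Prop :=
  exists M omega : R, [/\ 0 < M, 0 < omega &
    forall (t : R) x, 0 <= t -> `|T t x| <= M * expR (- (omega * t)) * `|x|].

(* The unbounded operator A is given by its domain D and by a total function
   whose values outside D are irrelevant. *)
Definition is_generator (T : R -> {linear X -> X}) (D : set X) (A : X -> X) :
    Prop :=
  D = [set x | cvg (h^-1 *: (T h x - x) @[h --> 0^'+])] /\
  forall x, D x -> h^-1 *: (T h x - x) @[h --> 0^'+] --> A x.

(* lam lies in the resolvent set of A, and Rlam = (lam - A)^-1. *)
Definition is_resolvent (D : set X) (A : X -> X) (lam : R)
    (Rlam : {linear X -> X}) : Prop :=
  [/\ continuous Rlam,
      forall x, D (Rlam x) /\ lam *: Rlam x - A (Rlam x) = x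
    & forall x, D x -> Rlam (lam *: x - A x) = x].

End Semigroups.

Section Extrapolation.
Context {R : realType} {X Xm1 : completeNormedModType R}.

(* The Banach space Xm1, with the embedding iota of X, is a completion of X
   for the norm x |-> |(lam - A)^-1 x|. *)
Definition is_extrapolation_space (Rlam : {linear X -> X})
    (iota : {linear X -> Xm1}) : Prop :=
  (forall x, `|iota x| = `|Rlam x|) /\ dense (range iota).

Definition is_extrapolated_semigroup (iota : {linear X -> Xm1})
    (T : R -> {linear X -> X}) (Tm1 : R -> {linear Xm1 -> Xm1}) : Prop :=
  C0_semigroup Tm1 /\ forall (t : R) x, 0 <= t -> Tm1 t (iota x) = iota (T t x).

(* The element of X identified with y through iota; 0 if there is none. *)
Definition X_part (iota : {linear X -> Xm1}) (y : Xm1) : X :=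
  xget 0 [set x | iota x = y].

(* f in L^q([0, t], X), for f with values in Xm1. *)
Definition in_LqX (iota : {linear X -> Xm1}) (t : R) (q : \bar R)
    (f : R -> Xm1) : Prop :=
  {ae lebesgue_measure, forall x : R, x \in `[0, t] -> range iota (f x)} /\
  in_Lp t q (X_part iota \o f).

(* Infinite outside L^q([0, t], X), so that a finite bound on the norm
   includes membership. *)
Definition LqX_norm (iota : {linear X -> Xm1}) (t : R) (q : \bar R)
    (f : R -> Xm1) : \bar R :=
  if `[< in_LqX iota t q f >] then Lp_norm t q (X_part iota \o f) else +oo%E.

End Extrapolation.

Section Systems.
Context {R : realType} {X Xm1 U : completeNormedModType R}.
Variables (iota : {linear X -> Xm1}) (T : R -> {linear X -> X})
  (Tm1 : R -> {linear Xm1 -> Xm1}) (B : {linear U -> Xm1}).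

Definition input_map (u : R -> U) (tau : R) : Xm1 :=
  bochner_integral tau (fun s => Tm1 (tau - s) (B (u s))).

Definition mild_solution (x : X) (u : R -> U) (tau : R) : Xm1 :=
  iota (T tau x) + input_map u tau.

Definition admissible (p q : \bar R) : Prop :=
  exists t : R, 0 < t /\
    forall u : R -> U, in_Lp t p u -> in_LqX iota t q (input_map u).

Definition infinite_time_admissible (p q : \bar R) : Prop :=
  admissible p q /\
  exists c : R, forall (t : R) (u : R -> U), 0 <= t -> in_Lp t p u ->
    (LqX_norm iota t q (input_map u) <= c%:E * Lp_norm t p u)%E.

Definition K_infty (gamma : R -> R) : Prop :=
  [/\ gamma 0 = 0,
      {within `[0, +oo[, continuous gamma},
      forall r s : R, 0 <= r -> r < s -> gamma r < gamma s
    & forall M : R, exists2 r : R, 0 <= r & M < gamma r].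

Definition ISS (p q : \bar R) : Prop :=
  admissible p q /\
  exists sigma gamma : R -> R, [/\ K_infty sigma, K_infty gamma &
    forall (t : R) (x : X) (u : R -> U), 0 <= t -> in_Lp t p u ->
      (LqX_norm iota t q (mild_solution x u)
         <= (sigma `|x| + gamma (fine (Lp_norm t p u)))%:E)%E].

End Systems.

(* Main.v *)
Require Import Defs.
From HB Require Import structures.
From mathcomp Require Import all_boot all_order all_algebra.
From mathcomp Require Import all_classical all_reals all_analysis.
From mathcomp Require Import measurable_realfun ess_sup_inf.
From mathcomp Require Import ring.
Import Order.TTheory GRing.Theory Num.Theory.
Import numFieldNormedType.Exports.

Set Implicit Arguments.
Unset Strict Implicit.
Unset Printing Implicit Defensive.

Local Open Scope classical_set_scope.
Local Open Scope ring_scope.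

(* (ISS => exponential stability) With zero input, homogeneity turns the ISS
   bound into ||T(.)x||_{L^q(0,t)} <= K |x| uniformly in t, and the Datko--Pazy
   argument applies; the linear input bound follows from homogeneity as well.
   Conversely, exponential stability bounds the L^q norm of the orbits, and
   Minkowski's inequality adds the contribution of the input.  Homogeneity of
   the input map requires uniqueness of the Bochner integral, which is defined
   by choice.  Strongly measurable functions are Lebesgue but not necessarily
   Borel measurable, hence the passage to almost everywhere equal Borel
   functions. *)

(** * Monotonicity and homogeneity of integrals and [L^p] norms *)

Section integral_without_measurability.
Context d {T : measurableType d} {R : realType}.
Variable mu : {measure set T -> \bar R}.
Local Open Scope ereal_scope.

Import HBNNSimple.

(* The integral of a nonnegative function is a supremum over simple functions
   below it, so monotonicity needs no measurability. *)
Lemma ae_ge0_le_integralT (f g : T -> \bar R) :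
  (forall x, 0 <= f x) -> (forall x, 0 <= g x) ->
  {ae mu, forall x, f x <= g x} -> \int[mu]_x f x <= \int[mu]_x g x.
Proof.
move=> f0 g0 [N [mN muN0 subN]].
rewrite [leLHS]ge0_integralTE//; apply: ge_ereal_sup => _ [h /= hf <-].
have mh : measurable_fun [set: T] (h : T -> R) by [].
(* A simple function [h] below [f] lies below [g] only off the null set [N]. Deleting [N] keeps its
   integral and leaves a simple function below [g] everywhere. *)
have -> : sintegral mu h = \int[mu]_(x in [set: T] `\` N) (h x)%:E.
  rewrite -ge0_negligible_integral//; first by rewrite integral_nnsfun// patch_setT.
    exact/measurable_EFinP.
  by move=> x _; rewrite lee_fin.
have mTN : measurable ([set: T] `\` N) by exact: measurableD.
rewrite integral_nnsfun// [leRHS]ge0_integralTE//.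
rewrite mrestrict; apply: ereal_sup_ubound; exists (proj_nnsfun h mTN) => // x.
have /(congr1 (@^~ x))/= <- := mrestrict h mTN.
rewrite patchE; case: ifPn => // xN; rewrite ?g0//.
apply: (le_trans (hf x)); apply: contrapT => fg.
by move: xN; rewrite inE => -[_]; apply; exact: subN.
Qed.

Lemma ae_le_Lnorm (p : \bar R) (f g : T -> \bar R) : 1 <= p ->
  {ae mu, forall x, `|f x| <= `|g x|} -> 'N[mu]_p[f] <= 'N[mu]_p[g].
Proof.
rewrite unlock; case: p => [p||]//= p1 fg.
- have p0 : (0 <= p)%R by rewrite (le_trans ler01).
  apply: gt0_ler_poweR; rewrite ?invr_ge0//.
  + by rewrite in_itv/= leey andbT integral_ge0// => x _; exact: poweR_ge0.
  + by rewrite in_itv/= leey andbT integral_ge0// => x _; exact: poweR_ge0.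
  apply: ae_ge0_le_integralT => [x|x|]; [exact: poweR_ge0..|].
  apply: filterS fg => x fgx; apply: gt0_ler_poweR => //;
    by rewrite in_itv/= ?leey ?abse_ge0.
- by case: ifPn => // _; apply: le_ess_sup; apply: filterS fg.
Qed.

Lemma ae_eq_Lnorm (p : \bar R) (f g : T -> \bar R) : 1 <= p ->
  {ae mu, forall x, f x = g x} -> 'N[mu]_p[f] = 'N[mu]_p[g].
Proof.
move=> p1 fg; apply/eqP; rewrite eq_le !ae_le_Lnorm//.
  by apply: filterS fg => x ->.
by apply: filterS fg => x ->.
Qed.

Lemma ge0_LnormZl (p : \bar R) (f : T -> R) (c : R) : 1 <= p -> (0 <= c)%R ->
  measurable_fun [set: T] f ->
  'N[mu]_p[(fun x => (c * f x)%:E)] = c%:E * 'N[mu]_p[EFin \o f].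
Proof.
rewrite unlock; case: p => [p||]//= p1 c0 mf.
- have p0 : (0 < p)%R by rewrite (lt_le_trans ltr01).
  under eq_integral do rewrite normrM (ger0_norm c0) powRM// EFinM.
  have mfp : measurable_fun [set: T] (fun x => (`|f x| `^ p)%:E).
    apply/measurable_EFinP; apply: (measurableT_comp (measurable_powR p)).
    exact: measurableT_comp.
  have cp0 : 0 <= (c `^ p)%:E by rewrite lee_fin powR_ge0.
  rewrite ge0_integralZl//.
  rewrite poweRM//; last by rewrite integral_ge0// => x _; rewrite lee_fin powR_ge0.
  by rewrite poweR_EFin -powRrM divff ?gt_eqF// powRr1.
(* By convention the infinity norm is 0 when the whole space is null. *)
- case: ifPn => [mu0|_]; last by rewrite mule0.
   rewrite -(@ess_supZl _ _ _ mu (abse \o (EFin \o f)) c mu0 c0).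
  congr ess_sup; apply/funext => x /=.
  by rewrite normrM (ger0_norm c0).
Qed.

End integral_without_measurability.

(** * Simple functions and their integrals over [[0, t]] *)

Section simple_functions.
Context {R : realType}.

Lemma measurable_preimage_fimfun {V : normedModType R} (s : {fimfun R >-> V})
    (A : set V) : simple_measurable s ->
  measurable (s @^-1` A : set (measurableTypeR R)).
Proof.
move=> ms.
have -> : s @^-1` A = \bigcup_(v in range s `&` A) s @^-1` [set v].
  apply/seteqP; split=> [x Ax|x [v [_ Av] /= ->]//].
  by exists (s x) => //; split => //; exists x.
by apply: fin_bigcup_measurable => // ; apply: finite_setIl.
Qed.

Lemma simple_measurable_comp {V W : normedModType R} (phi : V -> W)
    (s : {fimfun R >-> V}) :
  simple_measurable s -> simple_measurable [fimfun of phi \o s].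
Proof.
by move=> ms v; rewrite comp_preimage; exact: measurable_preimage_fimfun.
Qed.

Lemma finite_range_pair {aT V W : Type} (s : {fimfun aT >-> V})
    (s' : {fimfun aT >-> W}) : finite_set (range (fun x => (s x, s' x))).
Proof.
apply: (@sub_finite_set _ _ (range s `*` range s')); last exact: finite_setX.
by move=> _ [x _ <-]; split; exists x.
Qed.

(** Common refinement of two simple functions: both are recovered from it by composing with a
    projection. *)
Definition pair_fimfun {aT V W : Type} (s : {fimfun aT >-> V})
    (s' : {fimfun aT >-> W}) : {fimfun aT >-> V * W} :=
  fimfun_Sub (mem_set (finite_range_pair s s')).

Lemma simple_measurable_pair {V W : normedModType R}
    (s : {fimfun R >-> V}) (s' : {fimfun R >-> W}) :
  simple_measurable s -> simple_measurable s' ->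
  simple_measurable (pair_fimfun s s').
Proof.
move=> ms ms' [v w].
have -> : pair_fimfun s s' @^-1` [set (v, w)] =
    s @^-1` [set v] `&` s' @^-1` [set w].
  by apply/seteqP; split=> x /= [-> ->].
exact: measurableI.
Qed.

Local Notation mu := (@lebesgue_measure R).
Let mass (t : R) (A : set R) : R := fine (mu (`[0, t] `&` A)).

Let massE t (A : set R) : measurable (A : set (measurableTypeR R)) ->
  mu (`[0, t] `&` A) = (mass t A)%:E.
Proof.
move=> mA; rewrite /mass fineK// ge0_fin_numE//.
apply: (@le_lt_trans _ _ (mu `[0, t])).
  by apply: le_measure; rewrite ?inE//; exact: measurableI.
by rewrite lebesgue_measure_itv/= lte_fin; case: ifP => _; rewrite ?ltry.
Qed.

(** Each level set of [phi \o s] is a finite disjoint union of level sets of [s], so the integral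
    may be summed over the finer partition. *)
Lemma simple_integral_comp {V W : normedModType R} (t : R) (phi : V -> W)
    (s : {fimfun R >-> V}) : simple_measurable s ->
  simple_integral t [fimfun of phi \o s] =
  \sum_(v \in range s) mass t (s @^-1` [set v]) *: phi v.
Proof.
move=> ms; rewrite /simple_integral/=.
transitivity (\sum_(w \in range (phi \o s)) \sum_(v \in range s)
    if phi v == w then mass t (s @^-1` [set v]) *: w else 0).
  apply: eq_fsbigr => w _.
  set P := range s `&` phi @^-1` [set w].
  have finP : finite_set P by exact: finite_setIl.
  have -> : mu (`[0, t] `&` (phi \o s) @^-1` [set w]) =
      (\sum_(v \in P) mass t (s @^-1` [set v]))%:E.
    have -> : `[0, t] `&` (phi \o s) @^-1` [set w] =
        \big[setU/set0]_(v \in P) (`[0, t] `&` s @^-1` [set v]).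
      rewrite fsbig_setU//; apply/seteqP; split=> [x [tx sx]|x [v [_ vw] [tx sx]]].
        by exists (s x) => //; split => //; exists x.
      by split => //=; rewrite sx.
    rewrite measure_fsbig//.
    - by rewrite -fsumEFin//; apply: eq_fsbigr => v _; exact: massE.
    - by move=> v _; exact: measurableI.
    - by move=> v v' _ _ [x [[_ /= <-] [_ /= <-]]].
  rewrite /= fsbig_finite//= scaler_suml -fsbig_finite// /P fsbig_mkcondr.
  apply: eq_fsbigr => v _; congr (if _ then _ else _).
  by apply/idP/eqP; rewrite inE.
have finr : finite_set (range (phi \o s)) by exact: (fimfunP [fimfun of phi \o s]).
rewrite exchange_fsbig//.
apply: eq_fsbigr => v /[1!inE] -[x _ <-].
(* For a fixed value [v] of [s], only the term [w = phi v] survives. *)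
rewrite (fsbigD1 (phi (s x)))//=; last by exists x.
rewrite eqxx fsbig1 ?addr0// => w [_ /= /eqP].
by rewrite eq_sym => /negbTE ->.
Qed.

(** Expanding [psi \o s] over the indicators of the level sets of [s] gives the Lebesgue integral
    the same shape as [simple_integral], so that the two can be compared termwise. *)
Lemma integral_comp_fimfun {V : normedModType R} (t : R) (psi : V -> R)
    (s : {fimfun R >-> V}) : simple_measurable s -> (forall v, 0 <= psi v) ->
  (\int[mu]_(x in `[0%R, t]) (psi (s x))%:E)%E =
  (\sum_(v \in range s) mass t (s @^-1` [set v]) * psi v)%:E.
Proof.
move=> ms psi0.
transitivity (\int[mu]_(x in `[0%R, t])
    (\sum_(v \in range s) (psi v)%:E * (\1_(s @^-1` [set v]) x)%:E))%E.
  apply: eq_integral => x _; rewrite (fsbigD1 (s x))//=; last by exists x.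
  rewrite fsbig1 => [|v [_ /= vs]].
    by rewrite adde0 indicE mem_set// mule1.
  by rewrite indicE memNset ?mule0// => /esym.
have mi v : measurable_fun `[0%R, t] (fun x : measurableTypeR R =>
    (psi v)%:E * (\1_(s @^-1` [set v]) x)%:E)%E.
  apply/measurable_EFinP; apply: measurable_funM => //.
  by apply: measurable_indic; exact: ms.
rewrite ge0_integral_fsum//; first last.
  by move=> v x _; rewrite -EFinM lee_fin mulr_ge0.
rewrite -fsumEFin//; apply: eq_fsbigr => v _.
rewrite ge0_integralZl//=; last by rewrite lee_fin.
  by rewrite integral_indic//= setIC massE// -EFinM mulrC.
by apply/measurable_EFinP; exact: measurable_indic.
Qed.

(** On the common partition given by the pair of [s] and [s'], this is the triangle inequality for
    finite sums. *)
Lemma simple_integralB_le {V : normedModType R} (t : R)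
    (s s' : {fimfun R >-> V}) : simple_measurable s -> simple_measurable s' ->
  (`|simple_integral t s - simple_integral t s'|%:E <=
   \int[mu]_(x in `[0%R, t]) `|s x - s' x|%:E)%E.
Proof.
move=> ms ms'; set z := pair_fimfun s s'.
have mz : simple_measurable z by exact: simple_measurable_pair.
have -> : simple_integral t s = simple_integral t [fimfun of fst \o z] by [].
have -> : simple_integral t s' = simple_integral t [fimfun of snd \o z] by [].
rewrite (integral_comp_fimfun t (psi := fun w => `|w.1 - w.2|) mz)//.
have finz : finite_set (range z) by exact: fimfunP.
rewrite !simple_integral_comp// !fsbig_finite//; rewrite -sumrB lee_fin.
apply: (le_trans (ler_norm_sum _ _ _)); apply: ler_sum => w _.
by rewrite -scalerBr normrZ ger0_norm// fine_ge0.
Qed.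

End simple_functions.

(* Instance search does not recognize lebesgue_measure as a measure. *)
#[local] Instance ae_lebesgue_filter (R : realType) :
    Filter (nbhs (almost_everywhere (@lebesgue_measure R))) :=
  @ae_filter_ringOfSetsType _ _ R (@lebesgue_measure R).

(** * Strong measurability, [L^p] norms of vector-valued functions, and the Bochner integral *)

Section strong_measurability.
Context {R : realType}.
Local Notation mu := (@lebesgue_measure R).

Lemma simple_approx_ae {V : normedModType R} (t : R) (f g : R -> V) s :
  {ae mu, forall x, x \in `[0, t] -> f x = g x} ->
  simple_approx t f s -> simple_approx t g s.
Proof.
move=> fg [ms sf]; split => //.
by apply: filterS2 fg sf => x fgx sfx tx; rewrite -fgx//; exact: sfx.
Qed.

Lemma simple_approx_comp {V W : normedModType R} (t : R) (phi : V -> W)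
    (f : R -> V) s : continuous phi -> simple_approx t f s ->
  simple_approx t (phi \o f) (fun n => [fimfun of phi \o s n]).
Proof.
move=> cphi [ms sf]; split=> [n|]; first exact: simple_measurable_comp.
apply: filterS sf => x sfx tx.
by apply: (@cvg_comp _ _ _ (fun n => s n x) phi _ _ _ (sfx tx)); exact: cphi.
Qed.

Lemma simple_approx_pair {V W : normedModType R} (t : R) (f : R -> V)
    (g : R -> W) s s' : simple_approx t f s -> simple_approx t g s' ->
  simple_approx t (fun x => (f x, g x)) (fun n => pair_fimfun (s n) (s' n)).
Proof.
move=> [ms sf] [ms' sg]; split=> [n|]; first exact: simple_measurable_pair.
by apply: filterS2 sf sg => x sfx sgx tx; apply: cvg_pair; [exact: sfx|exact: sgx].
Qed.

Lemma strongly_measurable_ae {V : normedModType R} (t : R) (f g : R -> V) :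
  {ae mu, forall x, x \in `[0, t] -> f x = g x} ->
  strongly_measurable t f -> strongly_measurable t g.
Proof. by move=> fg [s sf]; exists s; exact: simple_approx_ae sf. Qed.

Lemma strongly_measurable_cst {V : normedModType R} (t : R) (v : V) :
  strongly_measurable t (cst v).
Proof.
exists (fun=> cst_fimfun v); split=> [n w|]; last first.
  by apply: aeW => x _; exact: cvg_cst.
by rewrite preimage_cst; case: ifP.
Qed.

Lemma strongly_measurableZ {V : normedModType R} (t : R) (c : R) (f : R -> V) :
  strongly_measurable t f -> strongly_measurable t (fun x => c *: f x).
Proof.
move=> [s sf]; exists (fun n => [fimfun of ( *:%R c) \o s n]).
by apply: simple_approx_comp sf; exact: scaler_continuous.
Qed.

Lemma strongly_measurableD {V : normedModType R} (t : R) (f g : R -> V) :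
  strongly_measurable t f -> strongly_measurable t g ->
  strongly_measurable t (fun x => f x + g x).
Proof.
move=> [s sf] [s' sg].
exists (fun n => [fimfun of (fun w => w.1 + w.2) \o pair_fimfun (s n) (s' n)]).
by apply: (simple_approx_comp _ (simple_approx_pair sf sg)); exact: add_continuous.
Qed.

Lemma strongly_measurableB {V : normedModType R} (t : R) (f g : R -> V) :
  strongly_measurable t f -> strongly_measurable t g ->
  strongly_measurable t (fun x => f x - g x).
Proof.
move=> mf mg; apply: strongly_measurableD => //.
rewrite (_ : (fun x => - g x) = (fun x => (-1) *: g x)).
  exact: strongly_measurableZ.
by apply/funext => x; rewrite scaleN1r.
Qed.

Lemma strongly_measurable_fimfun {V : normedModType R} (t : R)
    (s : {fimfun R >-> V}) : simple_measurable s -> strongly_measurable t s.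
Proof.
by move=> ms; exists (fun=> s); split => //; apply: aeW => x _; exact: cvg_cst.
Qed.

(* A strongly measurable function is only Lebesgue measurable, whereas the
   integration theory is about Borel functions. *)
Lemma strongly_measurable_norm_ae {V : normedModType R} (t : R) (f : R -> V) :
  strongly_measurable t f ->
  exists2 G : R -> R, measurable_fun [set: measurableTypeR R] G &
    {ae mu, forall x,
      ((fun x => `|f x|%:E) \_ `[0%R, t])%E x = (G x)%:E}.
Proof.
move=> [s [ms sf]].
pose h n := (fun x : measurableTypeR R => `|s n x|) \_ `[0, t].
have mh n : measurable_fun [set: measurableTypeR R] (h n).
  apply/(measurable_restrictT _ _).1 => //; apply: measurable_funTS.
  move=> _ A _; rewrite setTI.
  exact: (measurable_preimage_fimfun (fun v => A `|v|) (ms n)).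
(* The limit superior is Borel measurable even where the sequence diverges, and almost everywhere it
   is the limit, namely the norm of [f] cut off outside [[0, t]]. *)
exists (fun x => fine (limn_esup (fun n => (h n x)%:E))).
  apply: (measurableT_comp (@fine_measurable R setT measurableT)).
  by apply: measurable_fun_limn_esup => n; exact/measurable_EFinP.
apply: filterS sf => x sfx.
have hx : (h n x)%:E @[n --> \oo] --> ((fun x => `|f x|%:E) \_ `[0%R, t])%E x.
  rewrite patchE /h; case: ifPn => [tx|/negbTE tx].
    under eq_fun do rewrite patchE tx.
    apply: cvg_EFin; first exact: nearW.
    by apply: cvg_norm; apply: sfx; rewrite inE in tx.
  by under eq_fun do rewrite patchE tx; exact: cvg_cst.
rewrite is_cvg_limn_esupE; last by apply/cvg_ex; eexists; exact: hx.
rewrite (cvg_lim _ hx)//.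
by rewrite patchE; case: ifPn.
Qed.

Lemma Lp_norm_ge0 {V : normedModType R} (t : R) p (f : R -> V) :
  (0 <= Lp_norm t p f)%E.
Proof. exact: Lnorm_ge0. Qed.

Lemma ae_le_Lp_norm {V W : normedModType R} (t : R) p (f : R -> V) (g : R -> W) :
  (1 <= p)%E -> {ae mu, forall x, x \in `[0, t] -> `|f x| <= `|g x|} ->
  (Lp_norm t p f <= Lp_norm t p g)%E.
Proof.
move=> p1 fg; apply: ae_le_Lnorm => //; apply: filterS fg => x fg.
rewrite !patchE; case: ifPn => // tx; rewrite /= lee_fin !normr_id; apply: fg.
by rewrite inE in tx.
Qed.

Lemma ae_eq_Lp_norm {V : normedModType R} (t : R) p (f g : R -> V) :
  (1 <= p)%E -> {ae mu, forall x, x \in `[0, t] -> f x = g x} ->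
  Lp_norm t p f = Lp_norm t p g.
Proof.
move=> p1 fg; apply/eqP; rewrite eq_le !ae_le_Lp_norm//.
  by apply: filterS fg => x fg /fg ->.
by apply: filterS fg => x fg /fg ->.
Qed.

Lemma Lp_norm0 {V : normedModType R} (t : R) p :
  (1 <= p)%E -> Lp_norm t p (cst 0 : R -> V) = 0%E.
Proof.
move=> p1; rewrite /Lp_norm (@eq_Lnorm _ _ _ mu p _ (cst 0%E)).
  by rewrite Lnorm0// gt_eqF// (lt_le_trans _ p1)// lte01.
by move=> x; rewrite patchE normr0; case: ifP.
Qed.

(** The constant is pulled out for a Borel representative of the norm of [f], and the result is
    carried back by almost everywhere equality. *)
Lemma Lp_normZ {V : normedModType R} (t : R) p (c : R) (f : R -> V) :
  (1 <= p)%E -> strongly_measurable t f ->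
  Lp_norm t p (fun x => c *: f x) = (`|c|%:E * Lp_norm t p f)%E.
Proof.
move=> p1 /strongly_measurable_norm_ae[G mG fG].
transitivity ('N[mu]_p[(fun x => (`|c| * G x)%:E)])%E.
  apply: ae_eq_Lnorm => //; apply: filterS fG => x; rewrite !patchE EFinM => <-.
  by case: ifPn => _; rewrite ?mule0// normrZ.
by rewrite ge0_LnormZl//; congr (_ * _)%E; apply/esym/ae_eq_Lnorm.
Qed.

(** Minkowski's inequality for Borel representatives [F], [G] of the norms, after the pointwise
    triangle inequality. *)
Lemma Lp_normD {V : normedModType R} (t : R) p (f g : R -> V) :
  (1 <= p)%E -> strongly_measurable t f -> strongly_measurable t g ->
  (Lp_norm t p (fun x => f x + g x)%R <= Lp_norm t p f + Lp_norm t p g)%E.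
Proof.
move=> p1 /strongly_measurable_norm_ae[F mF fF].
move=> /strongly_measurable_norm_ae[G mG gG].
rewrite /Lp_norm (ae_eq_Lnorm p1 fF) (ae_eq_Lnorm p1 gG).
apply: le_trans (eminkowski _ mF mG p1).
apply: ae_le_Lnorm => //; apply: filterS2 fF gG => x.
rewrite !patchE; case: ifPn => _ /= [fx] [gx]; rewrite -fx -gx.
  rewrite lee_fin normr_id ger0_norm ?ler_normD// addr_ge0//.
by rewrite normr0 addr0 normr0.
Qed.

(** Lets the triangle inequality and homogeneity of [Lp_norm] act on the integrals in the definition
    of the Bochner integral. *)
Lemma Lp_norm1 {V : normedModType R} (t : R) (f : R -> V) :
  Lp_norm t 1 f = (\int[mu]_(x in `[0%R, t]) `|f x|%:E)%E.
Proof.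
rewrite /Lp_norm Lnorm1 [RHS]integral_mkcond; apply: eq_integral => x _.
by rewrite !patchE; case: ifPn => _ /=; rewrite ?normr0// normr_id.
Qed.

(** The integrals of two approximating sequences differ by at most the [L^1] distance of [s n] and
    [s' n], hence by at most the sum of their [L^1] distances to [f], which tends to 0. *)
Lemma is_bochner_integral_unique {V : normedModType R} (t : R) (f : R -> V)
    (v w : V) :
  is_bochner_integral t f v -> is_bochner_integral t f w -> v = w.
Proof.
move=> [s [sf s0 sv]] [s' [s'f s'0 s'w]].
apply/eqP; rewrite -subr_eq0 -normr_eq0 eq_le normr_ge0 andbT.
pose I (s : nat -> {fimfun R >-> V}) n :=
  (\int[mu]_(x in `[0%R, t]) `|f x - s n x|%:E)%E.
have lim0 : limn (fun n => I s n + I s' n)%E = 0%E.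
  by apply/cvg_lim => //; rewrite -[0%E]adde0; apply: cvgeD.
have cvgd : `|simple_integral t (s n) - simple_integral t (s' n)|%:E
    @[n --> \oo] --> `|v - w|%:E.
  by apply: cvg_EFin; [exact: nearW|apply: cvg_norm; exact: cvgB].
rewrite -lee_fin -[leRHS]/(0%E) -lim0 -(cvg_lim _ cvgd)//; apply: lee_lim.
- by apply/cvg_ex; eexists; exact: cvgd.
- by apply/cvg_ex; exists (0 + 0)%E; apply: cvgeD.
apply: nearW => n; have [ms _] := sf; have [ms' _] := s'f.
apply: (le_trans (simple_integralB_le t (ms n) (ms' n))).
have mfs : strongly_measurable t (fun x => f x - s n x).
  by apply: strongly_measurableB; [exists s|exact: strongly_measurable_fimfun].
have mfs' : strongly_measurable t (fun x => f x - s' n x).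
  by apply: strongly_measurableB; [exists s'|exact: strongly_measurable_fimfun].
rewrite /I -!Lp_norm1.
(* A sum with a scalar multiple is the form to which [Lp_normD] and [Lp_normZ] apply. *)
rewrite (_ : (fun x => s n x - s' n x) =
    (fun x => (f x - s' n x) + (-1) *: (f x - s n x))); last first.
  by apply/funext => x; rewrite scaleN1r opprB [RHS]addrC addrA subrK.
apply: le_trans (Lp_normD _ _ _) _ => //; first exact: strongly_measurableZ.
by rewrite Lp_normZ// normrN1 mul1e addeC.
Qed.

Lemma is_bochner_integralZ {V : normedModType R} (t : R) (c : R) (f : R -> V)
    (v : V) :
  is_bochner_integral t f v -> is_bochner_integral t (fun x => c *: f x) (c *: v).
Proof.
move=> [s [sf s0 sv]]; exists (fun n => [fimfun of ( *:%R c) \o s n]); split.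
- by apply: simple_approx_comp sf; exact: scaler_continuous.
- rewrite -[0%E](mule0 `|c|%:E).
  have -> : (fun n => (\int[mu]_(x in `[0%R, t])
        `|(c *: f x - [fimfun of ( *:%R c) \o s n] x)%R|%:E)%E)
      = (fun n => `|c|%:E * \int[mu]_(x in `[0%R, t]) `|(f x - s n x)%R|%:E)%E.
    apply/funext => n; have [ms _] := sf.
    rewrite -!Lp_norm1 -Lp_normZ//; last first.
      by apply: strongly_measurableB; [exists s|exact: strongly_measurable_fimfun].
    by congr (Lp_norm _ _ _); apply/funext => x /=; rewrite scalerBr.
  exact: cvgeZl.
- have -> : (fun n => simple_integral t [fimfun of ( *:%R c) \o s n]) =
      (fun n => c *: simple_integral t (s n)).
    apply/funext => n; have [ms _] := sf.
    rewrite simple_integral_comp// /simple_integral !fsbig_finite// scaler_sumr.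
    by apply: eq_bigr => w _; rewrite !scalerA mulrC.
  exact: cvgZr.
Qed.

(** Since [c] is invertible, [f] and its multiple are integrable together; if neither is, both
    integrals are the default 0. *)
Lemma bochner_integralZ {V : normedModType R} (t : R) (c : R) (f : R -> V) :
  c != 0 ->
  bochner_integral t (fun x => c *: f x) = c *: bochner_integral t f.
Proof.
move=> c0; rewrite /bochner_integral; case: xgetP => [v _ /= fv|nocf].
  have {}fv : is_bochner_integral t f (c^-1 *: v).
    rewrite (_ : f = fun x => c^-1 *: (c *: f x)).
      exact: is_bochner_integralZ.
    by apply/funext => x; rewrite scalerA mulVf// scale1r.
  rewrite (xget_unique 0 fv) ?scalerA ?mulfV ?scale1r// => w fw.
  exact: is_bochner_integral_unique fw fv.
rewrite xgetPN ?scaler0// => v fv.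
exact: nocf (is_bochner_integralZ c fv).
Qed.

End strong_measurability.

(** * A lower bound for [L^q] norms, and measurability from right continuity *)

Section norm_estimates.
Context {R : realType} {V : normedModType R}.
Local Notation mu := (@lebesgue_measure R).

(** The norm of [f] dominates [c] times the indicator of [[a, b]], whose [L^q] norm is explicit. *)
Lemma Lp_norm_ge (t a b c q : R) (f : R -> V) :
  0 <= a -> a <= b -> b <= t -> 0 <= c -> 1 <= q ->
  (forall s, a <= s <= b -> c <= `|f s|) ->
  ((c * (b - a) `^ q^-1)%:E <= Lp_norm t q%:E f)%E.
Proof.
move=> a0 ab bt c0 q1 cf; have q0 : 0 < q by rewrite (lt_le_trans ltr01).
have mab : measurable (`[a, b] : set (measurableTypeR R)) by [].
have mi : measurable_fun [set: measurableTypeR R] (\1_(`[a, b] : set R) : _ -> R).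
  exact: measurable_indic.
have <- : 'N[mu]_q%:E[(fun x => (c * \1_(`[a, b] : set R) x)%:E)]%E =
    (c * (b - a) `^ q^-1)%:E.
  rewrite ge0_LnormZl// EFinM; congr (_ * _)%E; rewrite unlock.
  rewrite (_ : (\int[mu]_x _)%E = (b - a)%:E) ?poweR_EFin//.
  have -> : (fun x => `|(EFin \o \1_(`[a, b] : set R)) x| `^ q)%E =
      (fun x => (\1_(`[a, b] : set R) x)%:E).
    apply/funext => x /=; rewrite indicE.
    by case: (_ \in _); rewrite /= ?normr1 ?powR1// normr0 powR0// gt_eqF.
  rewrite integral_indic//= setIT lebesgue_measure_itv/= lte_fin.
  (* When [a = b], the formula for the measure of an interval returns 0 by its case split, in
     agreement with [b - a]. *)
  by move: ab; rewrite le_eqVlt => /predU1P[->|->//]; rewrite ltxx subrr.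
apply: ae_le_Lnorm; first by rewrite lee_fin.
apply: aeW => x; rewrite indicE; case: (boolP (x \in _)) => [|_]; last first.
  by rewrite mulr0 abse0 abse_ge0.
rewrite inE/= in_itv/= => /andP[ax xb].
rewrite mulr1 patchE ifT ?inE/= ?in_itv/= ?(le_trans a0 ax) ?(le_trans xb bt)//.
by rewrite lee_fin normr_id ger0_norm// cf// ax.
Qed.

(* The simple functions sample f at the right endpoints of a grid of mesh
   1 / (n + 1), so that right continuity suffices. *)
Lemma right_continuous_strongly_measurable (t : R) (f : R -> V) :
  (forall s, 0 <= s -> f (s + h) @[h --> 0^'+] --> f s) ->
  strongly_measurable t f.
Proof.
move=> fr.
(* Capping the grid index by that of [t] makes the range finite; the cap has no effect for
   [x <= t]. *)
pose k n (x : R) := minn (Num.truncn (n.+1%:R * x)) (Num.truncn (n.+1%:R * t)).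
pose g n j := f (j.+1%:R / n.+1%:R).
have fin n : finite_set (range (fun x => g n (k n x))).
  apply: (@sub_finite_set _ _ (g n @` `I_(Num.truncn (n.+1%:R * t)).+1)).
    by move=> _ [x _ <-]; exists (k n x) => //=; rewrite ltnS geq_minr.
  exact/finite_image/finite_II.
pose s n : {fimfun R >-> V} := fimfun_Sub (mem_set (fin n)).
exists s; split.
  move=> n v.
  have -> : s n @^-1` [set v] =
      \bigcup_(j in `I_(Num.truncn (n.+1%:R * t)).+1 `&` [set j | g n j = v])
        (k n) @^-1` [set j].
    apply/seteqP; split=> [x /= gv|x [j [_ /= jv]] /= kj].
      by exists (k n x) => //; split => //=; rewrite ltnS geq_minr.
    by rewrite /= kj.
  apply: fin_bigcup_measurable; first exact/finite_setIl/finite_II.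
  (* [k n] is nondecreasing, so its level sets are intervals. *)
  move=> j _; apply: is_interval_measurable => x y /= kx ky z /andP[xz zy].
  have kmono u v' : u <= v' -> (k n u <= k n v')%N.
    move=> uv; rewrite /k leq_min geq_minr andbT.
    by apply: (leq_trans (geq_minl _ _)); apply: le_truncn; rewrite ler_pM2l.
  by apply/eqP; rewrite eqn_leq; apply/andP; split;
    [rewrite -ky|rewrite -kx]; exact: kmono.
apply: aeW => r; rewrite in_itv/= => /andP[r0 rt].
(* Step from [r] to the next grid point: strictly positive even if [r] lies on the grid, as the
   limit from the right demands. *)
pose h n := (Num.truncn (n.+1%:R * r)).+1%:R / n.+1%:R - r.
have h0 n : 0 < h n by rewrite subr_gt0 ltr_pdivlMr// mulrC truncnS_gt.
have hn n : h n <= n.+1%:R^-1.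
  rewrite /h lerBlDr ler_pdivrMr// mulrDl mulVf// -[X in X <= _]natr1 addrC lerD2l.
  rewrite [leRHS]mulrC.
  by have /andP[] := @truncn_itv R (n.+1%:R * r) (mulr_ge0 (ler0n _ _) r0).
have -> : (fun n => s n r) = (fun n => f (r + h n)).
  apply/funext => n; rewrite /= /g /k (minn_idPl _) ?subrKC//.
  by apply: le_truncn; rewrite ler_pM2l.
apply: (@cvg_comp _ _ _ h (fun y => f (r + y)) _ (0^'+)); last exact: fr.
move=> A [e /= e0 eA]; near=> n.
apply: eA => //=; rewrite sub0r normrN gtr0_norm//.
apply: (le_lt_trans (hn n)); near: n; exact: near_infty_natSinv_lt (PosNum e0).
Unshelve. all: by end_near. Qed.

End norm_estimates.

(** * Orbits, local boundedness and exponential stability of semigroups *)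

Section semigroups.
Context {R : realType} {X : completeNormedModType R}.
Variable T : R -> {linear X -> X}.
Hypothesis hT : C0_semigroup T.

(** Orbits are right continuous, because [T (s + h) x = T s (T h x)] and [T s] is continuous. *)
Lemma strongly_measurable_orbit (t : R) (x : X) :
  strongly_measurable t (fun s => T s x).
Proof.
have [cT _ TD T0] := hT.
apply: right_continuous_strongly_measurable => s s0.
apply: (@cvg_trans _ (T s (T h x) @[h --> 0^'+])).
  apply: near_eq_cvg; near=> h.
  by rewrite TD//; near: h; exact: nbhs_right_ge.
exact: (cvg_comp _ _ (T0 x) (cT s s0 x)).
Unshelve. all: by end_near. Qed.

(** Otherwise there are times tending to 0 at which the operator norms are unbounded. Strong
    continuity at 0 makes these operators pointwise bounded, against the Banach-Steinhaus
    theorem. *)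
Lemma C0_semigroup_bounded_near0 : exists delta M : R, [/\ 0 < delta, 0 < M &
  forall s x, 0 <= s <= delta -> `|T s x| <= M * `|x|].
Proof.
have [cT T0 TD Tx] := hT; apply: contrapT => nbd.
have /choice[sx hsx] : forall n : nat, exists sx : R * X,
    0 <= sx.1 <= n.+1%:R^-1 /\ n.+1%:R * `|sx.2| < `|T sx.1 sx.2|.
  move=> n; apply: contrapT => nsx; apply: nbd.
  exists n.+1%:R^-1, n.+1%:R; split=> // s x sn; rewrite leNgt; apply/negP => xT.
  by apply: nsx; exists (s, x).
pose F := [set f : X -> X | exists n, f = T (sx n).1].
have /(_ 1)[M FM] : uniform_bounded F.
  apply: Banach_Steinhauss => [_ [n ->]|x].
    split; last exact: linearP.
    have /andP[s0 _] := (hsx n).1.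
    exact/bounded_funP/linear_bounded_continuous/cT.
  have cx : T (sx n).1 x @[n --> \oo] --> x.
    apply/cvgrPdist_lt => e e0.
    have /cvgrPdist_lt/(_ e e0)[d /= d0 dT] := Tx x.
    near=> n; have /andP[] := (hsx n).1.
    (* The limit from the right says nothing at time 0 itself, where [T] is the identity. *)
    rewrite le_eqVlt => /predU1P[<- _|s0 sn]; first by rewrite T0 subrr normr0.
    apply: dT => //=; rewrite sub0r normrN gtr0_norm//; apply: (le_lt_trans sn).
    by near: n; exact: near_infty_natSinv_lt (PosNum d0).
  have /cvg_seq_bounded/pinfty_ex_gt0[M M0 /= hM] :
    cvgn (fun n => T (sx n).1 x) by apply/cvg_ex; exists x.
  by exists M => _ [n ->]; exact: hM.
(* [M < n + 1] for this [n], so the normalized vector [(sx n).2] violates the uniform bound. *)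
pose n := Num.truncn M; have [_ Tn] := hsx n.
have x0 : 0 < `|(sx n).2|.
  rewrite normr_gt0; apply: contraTneq Tn => ->.
  by rewrite linear0 normr0 mulr0 ltxx.
have : `|T (sx n).1 (`|(sx n).2|^-1 *: (sx n).2)| <= M.
  apply: FM; first by exists n.
  by rewrite normrZ normfV normr_id mulVf// gt_eqF.
rewrite linearZ/= normrZ normfV normr_id ler_pdivrMl// leNgt => /negP; apply.
apply: le_lt_trans Tn; rewrite mulrC ler_pM2r//; exact/ltW/truncnS_gt.
Unshelve. all: by end_near. Qed.

(* Datko--Pazy: integrating [|T t x| <= M |T s x|] over [s] near [t] bounds
   the semigroup, and integrating [|T t x| <= L |T s x|] over [0, t] then gives
   decay like [t ^ (-1 / q)]. *)
Lemma datko_pazy (q K : R) : 1 <= q -> 0 <= K ->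
  (forall t x, 0 <= t -> (Lp_norm t q%:E (T^~ x) <= (K * `|x|)%:E)%E) ->
  exponentially_stable T.
Proof.
move=> q1 K0 hK; have [cT T0 TD Tx] := hT.
have q0 : 0 < q by rewrite (lt_le_trans ltr01).
have [delta [M [d0 M0 hM]]] := C0_semigroup_bounded_near0.
have intle a b t x c : 0 <= a -> a <= b -> b <= t -> 0 <= c ->
    (forall s, a <= s <= b -> c <= `|T s x|) ->
    c * (b - a) `^ q^-1 <= K * `|x|.
  move=> a0 ab bt c0 cT'; rewrite -lee_fin.
  apply: le_trans (hK t x _); last by rewrite (le_trans a0)// (le_trans ab).
  exact: Lp_norm_ge.
have Tsub t s x : 0 <= s <= t -> T t x = T (t - s) (T s x).
  by move=> /andP[s0 st]; rewrite -TD ?subr_ge0// subrK.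
have dq0 : 0 < delta `^ q^-1 by rewrite powR_gt0.
(* The first summand bounds [T t] for [t <= delta]; the second comes from integrating over
   [[t - delta, t]] for larger [t]. *)
pose L := M + M * K / delta `^ q^-1.
have L0 : 0 < L by rewrite ltr_wpDr// mulr_ge0 ?invr_ge0 ?powR_ge0// mulr_ge0// ltW.
have hL t x : 0 <= t -> `|T t x| <= L * `|x|.
  move=> t0; have [td|dt] := leP t delta.
    apply: (le_trans (hM _ _ _)); first by rewrite t0.
    by rewrite ler_wpM2r// lerDl mulr_ge0 ?invr_ge0 ?powR_ge0// mulr_ge0// ltW.
  have h : `|T t x| / M * delta `^ q^-1 <= K * `|x|.
    rewrite -[X in X `^ _](subKr t); apply: (@intle _ _ t) => //.
    - by rewrite subr_ge0 ltW.
    - by rewrite gerBl ltW.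
    - by rewrite divr_ge0// ltW.
    move=> s /andP[s1 s2]; rewrite ler_pdivrMr// mulrC.
    rewrite (Tsub t s); last by rewrite s2 andbT (le_trans _ s1)// subr_ge0 ltW.
    by apply: hM; rewrite subr_ge0 s2 lerBlDl -lerBlDr.
  rewrite mulrAC ler_pdivrMr// -ler_pdivlMr// in h.
  apply: (le_trans h); rewrite /L mulrDl ler_wpDl ?mulr_ge0 ?(ltW M0)//.
  by rewrite le_eqVlt; apply/orP; left; apply/eqP; ring.
(* Large enough that [L * K] divided by the [q]-th root of [t0] is at most [expR (-1)]; adding 1
   keeps [t0] positive when [K = 0]. *)
pose t0 := (expR 1 * L * K) `^ q + 1.
have t00 : 0 < t0 by rewrite ltr_wpDl// powR_ge0.
have eLK0 : 0 <= expR 1 * L * K by rewrite mulr_ge0// mulr_ge0 ?expR_ge0// ltW.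
have ht0 x : `|T t0 x| <= expR (-1) * `|x|.
  have h : `|T t0 x| / L * t0 `^ q^-1 <= K * `|x|.
    rewrite -[X in X `^ _]subr0; apply: (@intle _ _ t0) => //; first exact: ltW.
      by rewrite divr_ge0// ltW.
    move=> s s1; rewrite ler_pdivrMr// mulrC (Tsub t0 s)//.
    by apply: hL; have /andP[_] := s1; rewrite subr_ge0.
  have t0q : expR 1 * L * K <= t0 `^ q^-1.
    rewrite -[leLHS](powRr1 eLK0) -[X in _ `^ X](divff (lt0r_neq0 q0)).
    rewrite powRrM; apply: ge0_ler_powR; rewrite ?invr_ge0 ?(ltW q0)//.
    - by rewrite nnegrE powR_ge0.
    - by rewrite nnegrE ltW.
    - by rewrite lerDl.
  have t0q0 : 0 < t0 `^ q^-1 by rewrite powR_gt0.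
  rewrite mulrAC ler_pdivrMr// -ler_pdivlMr// in h.
  apply: (le_trans h); rewrite ler_pdivrMr// expRN.
  rewrite -[leRHS]mulrA ler_pdivlMl ?expR_gt0//.
  have -> : expR 1 * (K * `|x| * L) = `|x| * (expR 1 * L * K).
    by ring.
  by rewrite ler_wpM2l.
have hn n x : `|T (n%:R * t0) x| <= expR (- n%:R) * `|x|.
  elim: n x => [|n IH] x; first by rewrite mul0r T0 oppr0 expR0 mul1r.
  rewrite -natr1 mulrDl mul1r TD ?mulr_ge0 ?(ltW t00)//.
  apply: (le_trans (IH _)); rewrite opprD expRD -mulrA.
  by rewrite ler_pM2l ?expR_gt0.
(* After [n] whole periods [t0], the remaining time costs the factor [L]. As [n + 1 > t / t0], the
   decay [expR (- n%:R)] is at most [expR 1] times the exponential of [- t / t0]. *)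
exists (L * expR 1), t0^-1; split;
  [by rewrite mulr_gt0 ?expR_gt0|by rewrite invr_gt0|].
move=> t x tge0; pose n := Num.truncn (t / t0).
have /andP[nt tn] := @truncn_itv R (t / t0) (divr_ge0 tge0 (ltW t00)).
rewrite (Tsub t (n%:R * t0)); last by rewrite mulr_ge0 ?(ltW t00)//= -ler_pdivlMr.
apply: (le_trans (hL _ _ _)); first by rewrite subr_ge0 -ler_pdivlMr.
rewrite -!mulrA ler_pM2l//; apply: (le_trans (hn _ _)); rewrite mulrA -expRD.
rewrite ler_wpM2r// ler_expR lerNl opprD opprK addrC lerBlDr mulrC natr1.
exact: ltW.
Qed.

End semigroups.

(** The integral of the [q]-th power of the decay is read off from the exponential distribution of
    rate [omega * q], whose density has mass 1. The bound is uniform in [t]. *)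
Lemma Lp_norm_exp_decay {R : realType} {V : normedModType R} (t q M omega c : R)
    (f : R -> V) : 1 <= q -> 0 < M -> 0 < omega -> 0 <= c ->
  (forall s, 0 <= s -> `|f s| <= M * expR (- (omega * s)) * c) ->
  (Lp_norm t q%:E f <= (M / (omega * q) `^ q^-1 * c)%:E)%E.
Proof.
move=> q1 M0 o0 c0 hf; have q0 : 0 < q by rewrite (lt_le_trans ltr01).
pose r := omega * q; have r0 : 0 < r by rewrite mulr_gt0.
have rq0 : 0 < r `^ q^-1 by rewrite powR_gt0.
(* [G] has [L^q] norm 1 and, for [s >= 0], equals the exponential of [- omega * s] times the [q]-th
   root of [r]. *)
pose G s := exponential_pdf r s `^ q^-1.
have mG : measurable_fun [set: measurableTypeR R] G.
  apply: (measurableT_comp (measurable_powR q^-1)).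
  exact: measurable_exponential_pdf.
have K0 : 0 <= M / r `^ q^-1 * c by rewrite mulr_ge0// divr_ge0 ?powR_ge0// ltW.
have -> : (M / r `^ q^-1 * c)%:E =
    'N[lebesgue_measure]_q%:E[(fun s => (M / r `^ q^-1 * c * G s)%:E)]%E.
  rewrite ge0_LnormZl// -[LHS]mule1; congr (_ * _)%E; rewrite unlock.
  have -> : (fun s => `|(EFin \o G) s| `^ q)%E =
      (fun s => (exponential_pdf r s)%:E).
    apply/funext => s /=; rewrite ger0_norm ?powR_ge0//.
    by rewrite -powRrM mulVf ?gt_eqF// powRr1// exponential_pdf_ge0// ltW.
  by rewrite integral_exponential_pdf// poweR1r.
apply: ae_le_Lnorm; first by rewrite lee_fin.
apply: aeW => s; rewrite patchE; case: ifPn => [|_]; last by rewrite abse0 abse_ge0.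
rewrite inE/= in_itv/= => /andP[s0 _]; rewrite lee_fin normr_id.
apply: (le_trans (hf s s0)); rewrite ger0_norm; last first.
  by apply: mulr_ge0 => //; exact: powR_ge0.
rewrite /G exponential_pdfE// powRM ?expR_ge0 ?(ltW r0)// -expRM.
have -> : - r * s * q^-1 = - (omega * s).
  by rewrite /r; field; rewrite gt_eqF.
by rewrite le_eqVlt; apply/orP; left; apply/eqP; field; rewrite gt_eqF.
Qed.

(** * Recovering elements of [X] inside the extrapolation space *)

Section extrapolation.
Context {R : realType} {X Xm1 : completeNormedModType R}.
Variable iota : {linear X -> Xm1}.
Hypothesis iota_inj : injective iota.

Lemma X_partK x : X_part iota (iota x) = x.
Proof. by rewrite /X_part; apply: xget_unique => // y /iota_inj. Qed.

(** A nonzero multiple of [y] is in the range of [iota] only if [y] is; off the range both sides are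
    the default 0. *)
Lemma X_partZ c y : c != 0 -> X_part iota (c *: y) = c *: X_part iota y.
Proof.
move=> c0; rewrite {2}/X_part; case: xgetP => [x _ /= <-|ny].
  by rewrite -linearZ X_partK.
rewrite scaler0; apply: xgetPN => x /= xy; apply: (ny (c^-1 *: x)).
by rewrite /= linearZ/= xy scalerA mulVf// scale1r.
Qed.

Lemma LqX_norm_leP t q (f : R -> Xm1) (r : \bar R) : (r < +oo)%E ->
  (LqX_norm iota t q f <= r)%E <->
  in_LqX iota t q f /\ (Lp_norm t q (X_part iota \o f) <= r)%E.
Proof.
move=> roo; rewrite /LqX_norm; case: asboolP => [fL|nfL].
  by split=> [|[]].
by split=> [|[]//]; rewrite leye_eq => /eqP roo'; rewrite roo' in roo.
Qed.

Lemma LqX_normZ_le t q c (f : R -> Xm1) : (1 <= q)%E -> c != 0 ->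
  (LqX_norm iota t q (fun s => c *: f s) <= `|c|%:E * LqX_norm iota t q f)%E.
Proof.
move=> q1 c0; rewrite {2}/LqX_norm.
case: asboolP => [[fr [mf foo]]|nfL]; last first.
  (* Here [LqX_norm] of [f] is infinite, and so is its multiple by the positive number [|c|]. *)
  by rewrite gt0_muley ?leey// lte_fin normr_gt0.
have Xc : X_part iota \o (fun s => c *: f s) = (fun s => c *: (X_part iota \o f) s).
  by apply/funext => s /=; rewrite X_partZ.
have cfoo : (`|c|%:E * Lp_norm t q (X_part iota \o f) < +oo)%E.
  by rewrite lte_mul_pinfty// lee_fin.
apply/LqX_norm_leP => //; rewrite /in_LqX /in_Lp Xc Lp_normZ//; split => //.
split; last by split => //; exact: strongly_measurableZ.
by apply: filterS fr => s fr /fr[x _ <-]; exists (c *: x) => //; rewrite linearZ.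
Qed.

End extrapolation.

(** * Homogeneity of the input map, and mild solutions with zero input or zero state *)

Section input_maps.
Context {R : realType} {X Xm1 U : completeNormedModType R}.
Variables (iota : {linear X -> Xm1}) (T : R -> {linear X -> X})
  (Tm1 : R -> {linear Xm1 -> Xm1}) (B : {linear U -> Xm1}).

Lemma input_mapZ c (u : R -> U) tau : c != 0 ->
  input_map Tm1 B (fun s => c *: u s) tau = c *: input_map Tm1 B u tau.
Proof.
move=> c0; rewrite /input_map -bochner_integralZ//.
by congr bochner_integral; apply/funext => s; rewrite !linearZ.
Qed.

(** Doubling the zero input leaves it unchanged, so by homogeneity its image equals its own double;
    no Bochner integral is computed. *)
Lemma input_map0 tau : input_map Tm1 B (cst 0) tau = 0.
Proof.
have := @input_mapZ 2 (cst 0) tau.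
rewrite (_ : (fun s : R => _) = cst 0); last by apply/funext => s; rewrite scaler0.
move=> /(_ (lt0r_neq0 (ltr0n _ 2))).
by rewrite scaler_nat mulr2n => /esym/eqP; rewrite -subr_eq0 addrK => /eqP.
Qed.

Lemma mild_solution_input0 x :
  mild_solution iota T Tm1 B x (cst 0) = (fun s => iota (T s x)).
Proof. by apply/funext => s; rewrite /mild_solution input_map0 addr0. Qed.

Lemma mild_solution_state0 u :
  mild_solution iota T Tm1 B 0 u = input_map Tm1 B u.
Proof. by apply/funext => s; rewrite /mild_solution !linear0 add0r. Qed.

Lemma in_Lp0 t p : (1 <= p)%E -> in_Lp t p (cst 0 : R -> U).
Proof.
by move=> p1; split; [exact: strongly_measurable_cst|rewrite Lp_norm0].
Qed.

Lemma K_infty_scale (c : R) : 0 < c -> K_infty ( *%R c).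
Proof.
move=> c0; split=> [||r s _ rs|M].
- by rewrite mulr0.
- by apply: continuous_subspaceT; exact: mulrl_continuous.
- by rewrite ltr_pM2l.
- exists (c^-1 * (`|M| + 1)); first by rewrite mulr_ge0 ?invr_ge0 ?addr_ge0// ltW.
  by rewrite mulrA mulfV ?gt_eqF// mul1r (le_lt_trans (ler_norm M))// ltrDl.
Qed.

End input_maps.

(** The norm of [iota x] is that of [Rlam x], and [Rlam] is injective because it has a left
    inverse. *)
Lemma extrapolation_embedding_inj {R : realType} {X Xm1 : completeNormedModType R}
    (D : set X) (A : X -> X) (lam : R) (Rlam : {linear X -> X})
    (iota : {linear X -> Xm1}) :
  is_resolvent D A lam Rlam -> is_extrapolation_space Rlam iota ->
  injective iota.
Proof.
move=> [_ DR _] [iotaR _] x y /eqP xy; apply/eqP; rewrite -subr_eq0.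
have Rz : Rlam (x - y) = 0.
  by apply/eqP; rewrite -normr_eq0 -iotaR normr_eq0 linearB subr_eq0.
(* [A] is a bare function, so instead of using [A 0 = 0], both [x - y] and 0 are written as
   [lam - A] applied to the same vector. *)
have [_ <-] := DR (x - y); have [_ <-] := DR 0.
by rewrite Rz linear0.
Qed.

(** * The implications between ISS, admissibility with stability, and the linear bound *)

Section equivalences.
Context {R : realType} {X U Xm1 : completeNormedModType R}.
Variables (T : R -> {linear X -> X}) (iota : {linear X -> Xm1})
  (Tm1 : R -> {linear Xm1 -> Xm1}) (B : {linear U -> Xm1}) (p : \bar R) (q : R).
Hypotheses (hT : C0_semigroup T) (iota_inj : injective iota)
  (p1 : (1 <= p)%E) (q1 : 1 <= q).
Local Notation mu := (@lebesgue_measure R).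

Let q1E : (1 <= q%:E)%E. Proof. by rewrite lee_fin. Qed.

(** With zero initial state, scaling the input to norm 1 turns [gamma] into the linear bound with
    constant [gamma 1]. *)
Lemma ISS_infinite_time_admissible : ISS iota T Tm1 B p q%:E ->
  infinite_time_admissible iota Tm1 B p q%:E.
Proof.
move=> [adm [sigma [gamma [[s0 _ _ _] [g0 _ gmono _] bound]]]].
have g1 : 0 < gamma 1 by rewrite -g0 gmono.
split=> //; exists (gamma 1) => t u t0 uL.
have [mu_ uoo] := uL.
have input_le v : in_Lp t p v ->
    (LqX_norm iota t q%:E (input_map Tm1 B v) <=
     (gamma (fine (Lp_norm t p v)))%:E)%E.
  by move=> vL; have := bound t 0 v t0 vL;
    rewrite mild_solution_state0 normr0 s0 add0r.
have aE : Lp_norm t p u = (fine (Lp_norm t p u))%:E.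
  by rewrite fineK// ge0_fin_numE// Lp_norm_ge0.
have a0 : 0 <= fine (Lp_norm t p u) by rewrite fine_ge0// Lp_norm_ge0.
rewrite aE; move: aE a0; set a := fine _ => aE.
rewrite le_eqVlt => /predU1P[a0|a0].
  (* An input of norm 0 cannot be normalized; [gamma 0 = 0] settles it directly. *)
  by rewrite -a0 mule0; have := input_le _ uL; rewrite aE /= -a0 g0.
have a0' : a != 0 by rewrite gt_eqF.
pose v s := a^-1 *: u s.
have vnorm : Lp_norm t p v = 1%E.
  by rewrite Lp_normZ// aE -EFinM ger0_norm ?invr_ge0 ?(ltW a0)// mulVf.
have vL : in_Lp t p v by split; [exact: strongly_measurableZ|rewrite vnorm ltry].
have -> : input_map Tm1 B u = (fun s => a *: input_map Tm1 B v s).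
  apply/funext => s; rewrite -input_mapZ//; congr input_map.
  by apply/funext => r; rewrite /v scalerA mulfV// scale1r.
apply: (le_trans (LqX_normZ_le iota_inj _ _ q1E a0')).
rewrite ger0_norm ?(ltW a0)// muleC.
apply: lee_wpmul2r; first by rewrite lee_fin ltW.
by have := input_le _ vL; rewrite vnorm.
Qed.

(** Zero input and initial states of norm 1 give the Datko-Pazy bound with constant [sigma 1]. *)
Lemma ISS_exponentially_stable :
  ISS iota T Tm1 B p q%:E -> exponentially_stable T.
Proof.
move=> [_ [sigma [gamma [[s0 _ smono _] [g0 _ _ _] bound]]]].
have s1 : 0 < sigma 1 by rewrite -s0 smono.
have orbit_le t x : 0 <= t -> (Lp_norm t q%:E (T^~ x) <= (sigma `|x|)%:E)%E.
  move=> t0; have := bound t x (cst 0) t0 (in_Lp0 t p1).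
  rewrite mild_solution_input0 Lp_norm0// g0 addr0.
  move=> /(LqX_norm_leP _ _ _ _ (ltry _))[_].
  by rewrite [X in Lp_norm _ _ X](_ : _ = T^~ x)//;
    apply/funext => s /=; rewrite X_partK.
apply: (@datko_pazy _ _ T hT q (sigma 1)) => // [|t x t0]; first exact: ltW.
have [->|x0] := eqVneq x 0.
  rewrite (_ : (fun s => T s 0) = cst 0); last first.
    by apply/funext => s; rewrite linear0.
  by rewrite Lp_norm0// normr0 mulr0.
have nx0 : `|x| != 0 by rewrite normr_eq0.
rewrite (_ : (fun s => T s x) = (fun s => `|x| *: T s (`|x|^-1 *: x))); last first.
  by apply/funext => s; rewrite linearZ/= scalerA mulfV// scale1r.
rewrite Lp_normZ//; last exact: strongly_measurable_orbit.
rewrite normr_id mulrC EFinM; apply: lee_wpmul2l => //.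
by have := orbit_le t (`|x|^-1 *: x) t0; rewrite normrZ normfV normr_id mulVf.
Qed.

Lemma admissible_stable_mild_bound :
  infinite_time_admissible iota Tm1 B p q%:E -> exponentially_stable T ->
  exists M G : R, [/\ 0 < M, 0 < G &
    forall (t : R) (x : X) (u : R -> U), 0 <= t -> in_Lp t p u ->
      (LqX_norm iota t q%:E (mild_solution iota T Tm1 B x u)
         <= M%:E * `|x|%:E + G%:E * Lp_norm t p u)%E].
Proof.
move=> [_ [c hc]] [M [omega [M0 o0 hM]]].
have q0 : 0 < q by rewrite (lt_le_trans ltr01).
exists (M / (omega * q) `^ q^-1), (Num.max c 1); split.
(* The constant for the state is that of [Lp_norm_exp_decay]; the maximum with 1 makes the input
   constant positive, whatever the sign of [c]. *)
- by rewrite divr_gt0// powR_gt0// mulr_gt0.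
- by rewrite lt_max ltr01 orbT.
move=> t x u t0 uL; have [mu_ uoo] := uL.
have cuoo : (c%:E * Lp_norm t p u < +oo)%E.
  by rewrite -(@fineK _ (Lp_norm t p u)) ?ltry// ge0_fin_numE// Lp_norm_ge0.
have [[ur [muin _]] uin] := (LqX_norm_leP iota t _ _ cuoo).1 (hc t u t0 uL).
have orbit_le := @Lp_norm_exp_decay _ _ t q M omega `|x| (T^~ x) q1 M0 o0
  (normr_ge0 x) (fun s s0 => hM s x s0).
have morbit := strongly_measurable_orbit hT t x.
(* [X_part] is additive only on the range of [iota], which contains the values of the input map
   almost everywhere. *)
have mildE : {ae mu, forall s, s \in `[0, t] ->
    T s x + (X_part iota \o input_map Tm1 B u) s =
    (X_part iota \o mild_solution iota T Tm1 B x u) s}.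
  apply: filterS ur => s us /us[y _ yE] /=.
  by rewrite /mild_solution -yE -linearD !X_partK.
have boundoo : ((M / (omega * q) `^ q^-1)%:E * `|x|%:E +
    (Num.max c 1)%:E * Lp_norm t p u < +oo)%E.
  by rewrite -(@fineK _ (Lp_norm t p u)) ?ltry// ge0_fin_numE// Lp_norm_ge0.
have normle : (Lp_norm t q%:E (X_part iota \o mild_solution iota T Tm1 B x u) <=
    (M / (omega * q) `^ q^-1)%:E * `|x|%:E + (Num.max c 1)%:E * Lp_norm t p u)%E.
  rewrite -(ae_eq_Lp_norm q1E mildE); apply: (le_trans (Lp_normD _ _ _)) => //.
  apply: leeD; first exact: orbit_le.
  apply: (le_trans uin); apply: lee_wpmul2r; first exact: Lp_norm_ge0.
  by rewrite lee_fin le_max lexx.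
apply: (LqX_norm_leP iota t _ _ boundoo).2; split => //; split.
  by apply: filterS ur => s us /us[y _ yE]; exists (T s x + y) => //;
     rewrite linearD yE.
split; last exact: le_lt_trans boundoo.
by apply: strongly_measurable_ae mildE _; exact: strongly_measurableD.
Qed.

(** Multiplications by [M] and [G] are functions in [K_infty]. Admissibility at time 1 follows from
    zero initial state, since a finite [LqX_norm] includes membership. *)
Lemma mild_bound_ISS :
  (exists M G : R, [/\ 0 < M, 0 < G &
    forall (t : R) (x : X) (u : R -> U), 0 <= t -> in_Lp t p u ->
      (LqX_norm iota t q%:E (mild_solution iota T Tm1 B x u)
         <= M%:E * `|x|%:E + G%:E * Lp_norm t p u)%E]) ->
  ISS iota T Tm1 B p q%:E.
Proof.
move=> [M [G [M0 G0 bound]]].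
have {}bound t x u : 0 <= t -> in_Lp t p u ->
    (LqX_norm iota t q%:E (mild_solution iota T Tm1 B x u)
       <= (M * `|x| + G * fine (Lp_norm t p u))%:E)%E.
  move=> t0 uL; apply: (le_trans (bound t x u t0 uL)); have [_ uoo] := uL.
  by rewrite EFinD !EFinM fineK// ge0_fin_numE// Lp_norm_ge0.
split; last by exists ( *%R M), ( *%R G); split => //; exact: K_infty_scale.
exists 1; split => // u uL.
have := bound 1 0 u ler01 uL.
by rewrite mild_solution_state0 => /(LqX_norm_leP _ _ _ _ (ltry _))[].
Qed.

End equivalences.

Theorem proposition3p4 (R : realType) (X U Xm1 : completeNormedModType R)
    (T : R -> {linear X -> X}) (D : set X) (A : X -> X)
    (lam : R) (Rlam : {linear X -> X})
    (iota : {linear X -> Xm1}) (Tm1 : R -> {linear Xm1 -> Xm1})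
    (B : {linear U -> Xm1}) (p : \bar R) (q : R)
    (hT : C0_semigroup T) (hA : is_generator T D A)
    (hlam : is_resolvent D A lam Rlam)
    (hX : is_extrapolation_space Rlam iota)
    (hTm1 : is_extrapolated_semigroup iota T Tm1)
    (hB : continuous B) (hp : (1 <= p)%E) (hq : 1 <= q) :
  [<-> ISS iota T Tm1 B p q%:E;
       infinite_time_admissible iota Tm1 B p q%:E /\ exponentially_stable T;
       exists M G : R, [/\ 0 < M, 0 < G &
         forall (t : R) (x : X) (u : R -> U), 0 <= t -> in_Lp t p u ->
           (LqX_norm iota t q%:E (mild_solution iota T Tm1 B x u)
              <= M%:E * `|x|%:E + G%:E * Lp_norm t p u)%E]].
Proof.
have iota_inj := extrapolation_embedding_inj hlam hX.
tfae.
- move=> iss; split; first exact: ISS_infinite_time_admissible iss.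
  exact: ISS_exponentially_stable iss.
- by move=> [adm stable]; exact: admissible_stable_mild_bound.
- exact: mild_bound_ISS.
Qed.
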